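(* Let $G$ be a compact abelian group whose (discrete) dual group $\Gamma=\widehat G$ has bounded torsion, i.e. there is a positive integer $N$ with $N\gamma=0$ for every $\gamma\in\Gamma$. Then a set $\Lambda\subseteq\Gamma\setminus\{0\}$ is Sidon if and only if $\Lambda$ is a finite union of quasi-independent sets.
   Context: $\Gamma=\widehat G$ is the group of continuous characters of $G$, written additively as an abstract group; an element $\gamma\in\Gamma$ is also regarded as the corresponding complex-valued function on $G$, and $0\in\Gamma$ denotes the trivial character. A subset $\Lambda\subseteq\Gamma\setminus\{0\}$ is called Sidon if there is a constant $S_\Lambda<\infty$ such that, for every finite set $F\subseteq\Lambda$ and every choice of complex scalar coefficients $(a_\gamma)_{\gamma\in F}$, $$\sum_{\gamma\in F}|a_\gamma|\leq S_\Lambda\left\|\sum_{\gamma\in F}a_\gamma\gamma\right\|_{L^\infty(G)}.$$ (By convention Sidon sets do not contain $0$.) A set $Q\subseteq\Gamma\setminus\{0\}$ (finite or infinite) is called quasi-independent if the only solution to $\sum_{\gamma\in Q}\epsilon_\gamma\gamma=0$ in $\Gamma$, with $\epsilon_\gamma\in\{-1,0,1\}$ and only finitely many nonzero coefficients, is the trivial one (all integers $\epsilon_\gamma$ equal to $0$). *)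

(* Defs.v *)
From HB Require Import structures.
From mathcomp Require Import all_boot all_order all_algebra finmap.
From mathcomp Require Import all_classical all_reals all_analysis.
From mathcomp Require Import complex.

Set Implicit Arguments.
Unset Strict Implicit.
Unset Printing Implicit Defensive.

Import Order.TTheory GRing.Theory Num.Theory.
Import numFieldNormedType.Exports.
Import Normc.

Local Open Scope classical_set_scope.
Local Open Scope ring_scope.

(* The cast to numFieldType gives R[i] the topology of its modulus. *)
Record dual_group (R : realType) (G : topologicalZmodType) := Dual {
  dual_fun :> G -> (R[i] : numFieldType);
  dual_fun_continuous : continuous dual_fun;
  dual_funD : forall x y, dual_fun (x + y) = dual_fun x * dual_fun y;
  dual_fun_norm : forall x, `|dual_fun x| = 1 }.

Section dual_zmodule.
Variables (R : realType) (G : topologicalZmodType).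
Implicit Types f g h : dual_group R G.

Lemma dual_eq f g : (f : G -> _) =1 g -> f = g.
Proof.
case: f g => [f fc fD fn] [g gc gD gn] /= /funext fg.
by case: _ / fg in gc gD gn *; congr Dual; exact: Prop_irrelevance.
Qed.

Lemma dual_fun_neq0 f x : f x != 0.
Proof. by rewrite -normr_eq0 dual_fun_norm oner_neq0. Qed.

Fact dual_zero_continuous : continuous (fun _ : G => 1 : (R[i] : numFieldType)).
Proof. by move=> x; exact: cvg_cst. Qed.
Fact dual_zeroD (x y : G) : 1 = 1 * 1 :> (R[i] : numFieldType).
Proof. by rewrite mulr1. Qed.
Fact dual_zero_norm (x : G) : `|1 : (R[i] : numFieldType)| = 1.
Proof. exact: normr1. Qed.
Definition dual_zero : dual_group R G := Dual dual_zero_continuous dual_zeroD dual_zero_norm.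

Fact dual_opp_continuous f : continuous (fun x => (f x)^-1).
Proof.
move=> x; apply: cvgV; first exact: dual_fun_neq0.
exact: dual_fun_continuous.
Qed.
Fact dual_oppD f x y : (f (x + y))^-1 = (f x)^-1 * (f y)^-1.
Proof. by rewrite dual_funD invfM. Qed.
Fact dual_opp_norm f x : `|(f x)^-1| = 1.
Proof. by rewrite normfV dual_fun_norm invr1. Qed.
Definition dual_opp f : dual_group R G :=
  Dual (@dual_opp_continuous f) (dual_oppD f) (dual_opp_norm f).

Fact dual_add_continuous f g : continuous (fun x => f x * g x).
Proof. by move=> x; apply: cvgM; exact: dual_fun_continuous. Qed.
Fact dual_addD f g x y : f (x + y) * g (x + y) = f x * g x * (f y * g y).
Proof. by rewrite !dual_funD mulrACA. Qed.
Fact dual_add_norm f g x : `|f x * g x| = 1.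
Proof. by rewrite normrM !dual_fun_norm mulr1. Qed.
Definition dual_add f g : dual_group R G :=
  Dual (@dual_add_continuous f g) (dual_addD f g) (dual_add_norm f g).

Fact dual_addA : associative dual_add.
Proof. by move=> f g h; apply: dual_eq => x /=; rewrite mulrA. Qed.

Fact dual_addC : commutative dual_add.
Proof. by move=> f g; apply: dual_eq => x /=; rewrite mulrC. Qed.

Fact dual_add0 : left_id dual_zero dual_add.
Proof. by move=> f; apply: dual_eq => x /=; rewrite mul1r. Qed.

Fact dual_addN : left_inverse dual_zero dual_opp dual_add.
Proof.
by move=> f; apply: dual_eq => x /=; rewrite mulVf// dual_fun_neq0.
Qed.

HB.instance Definition _ := gen_eqMixin (dual_group R G).
HB.instance Definition _ := gen_choiceMixin (dual_group R G).
HB.instance Definition _ :=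
  GRing.isZmodule.Build (dual_group R G) dual_addA dual_addC dual_add0 dual_addN.

End dual_zmodule.

(* G with its Borel sigma-algebra; an alias, since measurable types must be
   pointed and a topologicalZmodType is not. *)
Definition borelType (G : topologicalZmodType) : Type := G.

Section borel.
Variable G : topologicalZmodType.
HB.instance Definition _ := Choice.copy (borelType G) G.
HB.instance Definition _ := isPointed.Build (borelType G) (0 : G).
HB.instance Definition _ :=
  @isMeasurable.Build (sigma_display (@open G)) (borelType G) <<s @open G >>
    (@sigma_algebra0 _ setT _) (@sigma_algebraC (borelType G) _)
    (@sigma_algebra_bigcup _ setT _).
End borel.

(* Every Haar measure on a compact group is finite; it is normalized here.
   For a finite measure, inner regularity on all Borel sets yields outer
   regularity by complementation. *)
Definition is_haar (R : realType) (G : topologicalZmodType)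
    (mu : probability (borelType G) R) : Prop :=
  (forall (x : G) (A : set (borelType G)), measurable A ->
     mu ((fun y : G => x + y) @` A) = mu A) /\
  (forall A : set (borelType G), measurable A ->
     mu A = ereal_sup (mu @`
       [set K : set (borelType G) | @compact G K /\ K `<=` A])).

Definition bounded_torsion (V : zmodType) : Prop :=
  exists2 N : nat, (0 < N)%N & forall v : V, v *+ N = 0.

Definition sidon (R : realType) (G : topologicalZmodType)
    (mu : probability (borelType G) R) (L : set (dual_group R G)) : Prop :=
  ~ L 0 /\
  exists S : R, forall (F : {fset dual_group R G}) (a : dual_group R G -> R[i]),
    [set` F] `<=` L ->
    ((\sum_(g <- F) normc (a g))%:E <=
      S%:E * 'N[mu]_(+oo) [(fun x => (normc (\sum_(g <- F) a g * g x))%:E)])%E.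

Definition quasi_independent (V : zmodType) (Q : set V) : Prop :=
  ~ Q 0 /\
  forall e : V -> int,
    (forall v, e v \in [:: -1; 0; 1]) ->
    finite_set [set v | Q v /\ e v != 0] ->
    \sum_(v \in Q) v *~ e v = 0 ->
    forall v, Q v -> e v = 0.

(* Main.v *)
Require Import Defs.
From HB Require Import structures.
From mathcomp Require Import all_boot all_order all_algebra finmap.
From mathcomp Require Import all_classical all_reals all_analysis.
From mathcomp Require Import ess_sup_inf complex ring lra.

(** Let V be the dual group, N an exponent of V, and L a set of nonzero characters.
    Nonempty open sets have positive Haar measure, so the L^oo norm of a
    trigonometric polynomial is its supremum ([sidonP]).  After that, both
    implications are statements about finite sets of characters.

    Finite unions of quasi-independent sets are Sidon ([union_qi_sidon]).  Let
    a_g (g in F) be the coefficients of a polynomial f with spectrum F in L, let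
    F_i be the part of F in the i-th of n quasi-independent sets, and let
    0 <= d <= 1.  The Riesz product of the factors 1 + d Re (u_g g), g in F_i,
    |u_g| = 1, is nonnegative and has mean 1 by quasi-independence.  Its Fourier
    coefficients are of order d at the elements of F_i and their opposites, and
    at most d^2 at all other nonzero characters: a product of two or more factors
    d/2 is d^2 times the corresponding coefficient for d = 1, and these are
    nonnegative with sum at most 1 at each character.  Pairing two such products
    removes the opposites.  Testing f against the result, with u_g the phase of
    a_g, bounds d times the sum of |a_g| over F_i by 2 sup |f| plus 2 d^2 times
    the sum over the whole of F.  As the error is quadratic in d, adding up over
    i and taking d = 1/(4n) absorbs it.

    Sidon sets are finite unions of quasi-independent sets.  Call a finite set a
    core if each of its elements belongs to the subgroup generated by the others.
    A set without nonempty core is quasi-independent ([coreless_qi]), and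
    coreless sets can be handled with the closure operator alone:
    [coreless_colouring] says that a finite set is a union of m coreless sets as
    soon as no nonempty X has m disjoint subsets each generating X.  It is an
    exchange argument in the manner of the matroid partition theorem, although
    coreless sets do not form a matroid.  Its hypothesis holds in a Sidon set for
    large m, by [spanned_size]: if Y generates X, then the values on X of a point
    of G are determined by its values on Y, so that N^|Y| points suffice to test
    all sums of the elements of X with signs, and by the Chernoff bound
    [sign_count] that few points cannot make all 2^|X| sums of size at least
    |X|/(2S) unless |X| is bounded by a multiple of |Y|.  The number of colours
    does not depend on the finite part of L considered, and
    [colouring_compactness] passes to L. *)

Set Implicit Arguments.
Unset Strict Implicit.
Unset Printing Implicit Defensive.

Import Order.TTheory GRing.Theory Num.Theory.
Import numFieldNormedType.Exports.
Import Normc.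

(** * Coreless colourings for a closure operator *)

Section Coreless.
Import fintype boot.finset.
Variables (T : finType) (cl : {set T} -> {set T}).
Hypothesis cl_ext : forall S : {set T}, S \subset cl S.
Hypothesis cl_mono : forall S S' : {set T}, S \subset S' -> cl S \subset cl S'.
Hypothesis cl_idem : forall S, cl (cl S) = cl S.

(** For vectors, a core is a union of circuits.  For the closure that maps a set
    to the subgroup it generates, the support of a relation with coefficients
    1 and -1 is a core, but cores need not come from such relations. *)
Definition core (C : {set T}) := [forall s in C, s \in cl (C :\ s)].

Definition coreless (S : {set T}) :=
  [forall C : {set T}, (C \subset S) ==> core C ==> (C == set0)].

Lemma cl_subset (S S' : {set T}) : S \subset cl S' -> cl S \subset cl S'.
Proof. by move=> /cl_mono; rewrite cl_idem. Qed.

Lemma corelessP (S : {set T}) :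
  reflect (forall C : {set T}, C \subset S -> core C -> C = set0) (coreless S).
Proof.
apply: (iffP forallP) => h C; last first.
  by apply/implyP => CS; apply/implyP => kC; apply/eqP; exact: h.
by move: (h C) => /implyP h1 CS kC; apply/eqP; move: (h1 CS) => /implyP; apply.
Qed.

Lemma coreless_sub (S S' : {set T}) : S \subset S' -> coreless S' -> coreless S.
Proof.
move=> SS' /corelessP h; apply/corelessP => C CS; apply: h.
exact: subset_trans SS'.
Qed.

Lemma coreless0 : coreless set0.
Proof. by apply/corelessP => C; rewrite subset0 => /eqP. Qed.

Definition max_core (S : {set T}) :=
  \bigcup_(C : {set T} | core C && (C \subset S)) C.

Lemma max_core_sub S : max_core S \subset S.
Proof. by apply/bigcupsP => C /andP[]. Qed.

Lemma max_coreP S : core (max_core S).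
Proof.
apply/forallP => s; apply/implyP => /bigcupP[C /[dup] CP /andP[/forallP/(_ s)/implyP kC CS]] sC.
apply: subsetP (kC sC); apply/cl_mono/setSD.
exact: (bigcup_sup C).
Qed.

Lemma max_core_max (S C : {set T}) : core C -> C \subset S -> C \subset max_core S.
Proof. by move=> kC CS; apply: (bigcup_sup C) => //; rewrite kC. Qed.

(** The substitute for the fundamental circuit of a matroid: if S is coreless
    and x |: S is not, then every core of x |: S contains x, and their union is
    x together with the blocker. *)
Definition blocker S x := max_core (x |: S) :\ x.

Lemma blocker_sub S x : blocker S x \subset S.
Proof. by rewrite subDset max_core_sub. Qed.

Section Blocked.
Variables (S : {set T}) (x : T).
Hypotheses (Scl : coreless S) (Sx : ~~ coreless (x |: S)).
Local Notation B := (blocker S x).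

Lemma in_max_core : x \in max_core (x |: S).
Proof.
apply: contraNT Sx => xC; apply/corelessP => C CS kC.
have /subsetP CM := max_core_max kC CS.
move/corelessP: Scl => /(_ C); apply => //.
apply/subsetP => y yC; have /setU1P[yx|//] := subsetP CS _ yC.
by rewrite -[in X in X \notin _]yx CM in xC.
Qed.

Lemma blocker_core : core (x |: B).
Proof. by rewrite /blocker setD1K ?in_max_core ?max_coreP. Qed.

Lemma notin_blocker : x \notin B. Proof. by rewrite !inE eqxx. Qed.

Lemma cl_blocker : x \in cl B.
Proof.
have /forallP/(_ x) := blocker_core.
by rewrite setU11 setU1K ?notin_blocker.
Qed.

Lemma swap_cl s : s \in B -> s \in cl (x |: (B :\ s)).
Proof.
move=> sB; have /forallP/(_ s) := blocker_core.
rewrite inE sB orbT /=; apply: subsetP; apply: cl_mono.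
by apply/subsetP => y; rewrite !inE; case: (y == s) => //=.
Qed.

(** A core left after the exchange would avoid s and lie in x |: (B :\ s), hence
    put x in the closure of B :\ s, and then s as well. *)
Lemma swap_coreless s : s \in B -> s \notin cl (B :\ s) -> coreless (x |: (S :\ s)).
Proof.
move=> sB sNcl; apply/corelessP => C CS kC; apply/eqP; apply: contraNT sNcl => C0.
have CM : C \subset max_core (x |: S).
  by apply: max_core_max kC _; apply: subset_trans CS _; rewrite setUS ?subsetDl.
have xC : x \in C.
  apply: contraNT C0 => xC; apply/eqP; move/corelessP: Scl; apply => //.
  apply/subsetP => y yC; have := subsetP CS _ yC; rewrite !inE.
  by case: eqP => [yx|_ /andP[]//]; rewrite -yx yC in xC.
have sx : s != x by apply: contraTneq sB => ->; rewrite notin_blocker.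
have sC : s \notin C.
  by apply/negP => /(subsetP CS); rewrite !inE (negPf sx) eqxx.
have xcl : x \in cl (B :\ s).
  have /forallP/(_ x) := kC; rewrite xC; apply: subsetP; apply: cl_mono.
  apply/subsetP => y; rewrite !inE => /andP[yx yC]; rewrite yx.
  rewrite (subsetP CM _ yC) !andbT.
  by apply: contraNneq sC => <-.
apply: subsetP (swap_cl sB); apply: cl_subset.
by rewrite subUset sub1set xcl cl_ext.
Qed.

End Blocked.

Section Colouring.
Variable m : nat.
Local Notation col := {ffun T -> option 'I_m}.
Definition class (c : col) (j : 'I_m) := [set x | c x == Some j].
Definition proper_col (c : col) := [forall j, coreless (class c j)].
Definition recolor (c : col) x o : col := [ffun y => if y == x then o else c y].

(** A move tries to give the colour j to the uncoloured x.  If x is blocked, some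
    element s of the blocker B becomes uncoloured instead: it is just dropped
    when B :\ s still spans B, and x takes its place when it does not.  Every
    element of the blocker can be freed in this way, and no move shrinks the
    closure of the elements concerned. *)
Definition move_for (c : col) (x : T) (j : 'I_m) (c' : col) : bool :=
  let B := blocker (class c j) x in
  if coreless (x |: class c j) then c' == recolor c x (Some j)
  else [exists s in B,
    c' == if s \in cl (B :\ s) then recolor c s None
          else recolor (recolor c s None) x (Some j)].

Definition move (c c' : col) :=
  [exists x, exists j, (c x == None) && move_for c x j c'].

Definition loose (c : col) := [set x | [exists c', connect move c c' && (c' x == None)]].

Lemma class_recolor_None c s j : class (recolor c s None) j = class c j :\ s.
Proof. by apply/setP => y; rewrite !inE ffunE; case: (y == s). Qed.

Lemma class_recolor (c : col) x i j : c x = None ->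
  class (recolor c x (Some i)) j = if i == j then x |: class c j else class c j.
Proof.
move=> cx; apply/setP => y; rewrite inE ffunE.
case: (eqVneq y x) => [->|yx].
  have [<-|/eqP ij] := eqVneq i j; rewrite !inE ?eqxx ?cx//.
  by apply/eqP => -[].
by case: (i == j); rewrite !inE ?(negPf yx).
Qed.

Lemma move_forP (c : col) x j c' : c x = None -> move_for c x j c' ->
  [\/ coreless (x |: class c j) /\ c' = recolor c x (Some j),
    exists s, [/\ ~~ coreless (x |: class c j), s \in blocker (class c j) x,
      s \in cl (blocker (class c j) x :\ s) & c' = recolor c s None] |
    exists s, [/\ ~~ coreless (x |: class c j), s \in blocker (class c j) x,
      s \notin cl (blocker (class c j) x :\ s) &
      c' = recolor (recolor c s None) x (Some j)]].
Proof.
move=> cx; rewrite /move_for; case: ifPn => [h /eqP->|h]; first by constructor 1.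
move=> /existsP[s /andP[sB /eqP]]; case: ifPn => hs ->; last by constructor 3; exists s.
by constructor 2; exists s.
Qed.

Lemma blocker_colour (c : col) x j s : s \in blocker (class c j) x -> c s = Some j.
Proof. by move=> /(subsetP (blocker_sub _ _)); rewrite inE => /eqP. Qed.

Lemma move_proper c c' : proper_col c -> move c c' -> proper_col c'.
Proof.
move=> /forallP cP /existsP[x /existsP[j /andP[/eqP cx]]] /(move_forP cx) h.
apply/forallP => i; case: h => [[h ->]|[s [h sB scl ->]]|[s [h sB scl ->]]].
- by rewrite class_recolor//; case: eqP => [<-|].
- by rewrite class_recolor_None; apply: coreless_sub (cP i); rewrite subsetDl.
- rewrite class_recolor ?class_recolor_None.
    case: eqP => [<-|_]; first exact: swap_coreless.
    by apply: coreless_sub (cP i); rewrite subsetDl.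
  by rewrite ffunE cx; case: ifP.
Qed.

Lemma loose_trans c c' : connect move c c' -> loose c' \subset loose c.
Proof.
move=> cc'; apply/subsetP => x; rewrite !inE => /existsP[d /andP[c'd dx]].
by apply/existsP; exists d; rewrite (connect_trans cc').
Qed.

Lemma looseI (c : col) x : c x = None -> x \in loose c.
Proof. by move=> cx; rewrite inE; apply/existsP; exists c; rewrite connect0 cx. Qed.

Lemma move_loose c c' : move c c' -> loose c' \subset loose c.
Proof. by move=> /connect1/loose_trans. Qed.

Lemma blocker_loose (c : col) x j : proper_col c -> c x = None ->
  ~~ coreless (x |: class c j) -> blocker (class c j) x \subset loose c.
Proof.
move=> cP cx h; apply/subsetP => s sB.
set c' := if s \in cl (blocker (class c j) x :\ s) then recolor c s None
          else recolor (recolor c s None) x (Some j).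
have mv : move c c'.
  apply/existsP; exists x; apply/existsP; exists j; rewrite cx eqxx /=.
  by rewrite /move_for (negPf h); apply/existsP; exists s; rewrite sB eqxx.
apply: (subsetP (move_loose mv)); apply: looseI; rewrite /c'.
have sx : s != x by apply: contraTneq sB => ->; rewrite notin_blocker.
by case: ifP => _; rewrite !ffunE ?(negPf sx) eqxx.
Qed.

(** The monovariant.  The insertion adds a loose element to its class; the two
    other moves act inside a blocker, which consists of loose elements and keeps
    its closure. *)
Lemma move_cl c c' j : proper_col c -> move c c' ->
  cl (class c j :&: loose c) \subset cl (class c' j :&: loose c).
Proof.
move=> cP /existsP[x /existsP[i /andP[/eqP cx]]] /(move_forP cx) h.
have xX := looseI cx; set X := loose c in xX *.
have classC s o : c s = Some o -> j <> o -> class c j :\ s = class c j.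
  move=> cs jo; apply/setP => y; rewrite !inE.
  by case: eqP => //= ->; rewrite cs; apply/esym/negbTE/eqP => -[oj]; apply: jo.
case: h => [[h ->]|[s [h sB scl ->]]|[s [h sB scl ->]]].
- rewrite class_recolor//; apply/cl_mono/setSI.
  by case: ifP => // _; exact: subsetUr.
- have BX := blocker_loose cP cx h.
  rewrite class_recolor_None.
  have [ji|ji] := eqVneq j i; last by rewrite (classC _ i) ?(blocker_colour sB)//; apply/eqP.
  subst j; apply: cl_subset; apply/subsetP => y; rewrite inE => /andP[yc yX].
  have [->|ys] := eqVneq y s.
    apply: subsetP scl; apply: cl_mono; apply/subsetP => z /setD1P[zs zB].
    apply/setIP; split; last exact: (subsetP BX).
    by apply/setD1P; split=> //; exact: (subsetP (blocker_sub _ _) _ zB).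
  by apply: (subsetP (cl_ext _)); apply/setIP; split=> //; apply/setD1P.
- have BX := blocker_loose cP cx h.
  have rx : recolor c s None x = None by rewrite ffunE cx; case: ifP.
  rewrite class_recolor// class_recolor_None.
  case: eqP => [ij|ij]; last first.
    by rewrite (classC _ i) ?(blocker_colour sB)//; apply: nesym.
  subst j; apply: cl_subset; apply/subsetP => y; rewrite inE => /andP[yc yX].
  have [->|ys] := eqVneq y s.
    have := swap_cl (forallP cP i) h sB; apply: subsetP; apply: cl_mono.
    apply/subsetP => z; rewrite !in_setU1 => /predU1P[->|/setD1P[zs zB]].
      by rewrite inE setU11 xX.
    apply/setIP; split; last exact: (subsetP BX).
    by apply/setU1P; right; apply/setD1P; split=> //; exact: (subsetP (blocker_sub _ _) _ zB).
  apply: (subsetP (cl_ext _)); apply/setIP; split=> //.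
  by apply/setU1P; right; apply/setD1P.
Qed.

Lemma connect_proper c c' : proper_col c -> connect move c c' -> proper_col c'.
Proof.
move=> + /connectP[p]; elim: p c => [c cP _ ->//|d p IH c cP /= /andP[cd dp] c'E].
by apply: (IH d) => //; exact: move_proper cd.
Qed.

(** If no colouring were total, start from one with fewest loose elements, so that
    its set X of loose elements is that of every colouring reachable from it.
    Where the closures of the sets [class c j :&: X] are largest they no longer
    grow.  An element of X, once uncoloured, either enters class j or is in the
    closure of its blocker, so it lies in the closure of [class c j :&: X]: each
    of the m disjoint sets [class c j :&: X] spans X. *)
Lemma coreless_colouring :
  (forall (X : {set T}) (c : col), X != set0 ->
     exists j, ~~ (X \subset cl (class c j :&: X))) ->
  exists c : {ffun T -> 'I_m}, forall j, coreless [set x | c x == j].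
Proof.
move=> nospan.
have [/existsP[c /andP[cP /forallP ct]]|noc] :=
    boolP [exists c : col, proper_col c && [forall x, c x != None]].
  have [x0|noT] := pickP (fun _ : T => true); last first.
    have c0 : T -> 'I_m by move=> x; have := noT x.
    exists [ffun x => c0 x] => j; suff -> : [set x | [ffun y => c0 y] x == j] = set0 by exact: coreless0.
    by apply/setP => x; have := noT x.
  have [j0 _] : exists j0, c x0 = Some j0 by case: (c x0) (ct x0) => // j _; exists j.
  exists [ffun x => odflt j0 (c x)] => j.
  rewrite [X in coreless X](_ : _ = class c j); first exact: (forallP cP).
  by apply/setP => x; rewrite !inE ffunE; case: (c x) (ct x).
have unc c : proper_col c -> exists x, c x = None.
  move=> cP; suff /existsP[x /eqP cx] : [exists x, c x == None] by exists x.
  apply: contraR noc; rewrite negb_exists => /forallP h.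
  apply/existsP; exists c; rewrite cP /=; exact/forallP.
have [c0 c0P c0min] : exists2 c0, proper_col c0 &
    forall c, proper_col c -> #|loose c0| <= #|loose c|.
  have e0P : proper_col [ffun=> None].
    apply/forallP => j; suff -> : class [ffun=> None] j = set0 by exact: coreless0.
    by apply/setP => x; rewrite !inE ffunE.
  by case: (arg_minnP (fun c => #|loose c|) e0P) => c cP h; exists c.
have reach_loose c : connect move c0 c -> loose c = loose c0.
  move=> h; apply/eqP; rewrite eqEcard loose_trans//=; apply: c0min.
  exact: connect_proper h.
set X := loose c0.
have reach_cl c c' j : connect move c0 c -> connect move c c' ->
    cl (class c j :&: X) \subset cl (class c' j :&: X).
  move=> + /connectP[p]; elim: p c => [c c0c _ ->//|d p IH c c0c /= /andP[cd dp] c'E].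
  apply: subset_trans (IH d _ dp c'E); last exact: connect_trans (connect1 cd).
  rewrite /X -(reach_loose c)//; apply: move_cl => //; exact: connect_proper c0c.
have [c1 c01 c1max] : exists2 c1, connect move c0 c1 & forall c, connect move c0 c ->
    \sum_j #|cl (class c j :&: X)| <= \sum_j #|cl (class c1 j :&: X)|.
  case: (arg_maxnP (fun c => \sum_j #|cl (class c j :&: X)|) (connect0 move c0)) => c cc h.
  by exists c.
have c1cl c j : connect move c1 c -> cl (class c j :&: X) = cl (class c1 j :&: X).
  move=> c1c; have c0c := connect_trans c01 c1c.
  apply/esym/eqP; rewrite eqEcard reach_cl//=.
  have := c1max _ c0c; apply: contraTT; rewrite -!ltnNge => lt.
  rewrite (bigD1 j)//= [X in _ < X](bigD1 j)//= -addSn.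
  by apply: leq_add => //; apply: leq_sum => i _; rewrite subset_leq_card ?reach_cl.
have X0 : X != set0.
  by have [x xN] := unc _ c0P; apply/set0Pn; exists x; exact: looseI.
have [j] := nospan X c1 X0; rewrite /X -(reach_loose c1)// => /subsetPn[x].
rewrite inE => /existsP[c /andP[c1c /eqP cx]]; rewrite (reach_loose c1)//.
have cP := connect_proper (connect_proper c0P c01) c1c.
have c0c := connect_trans c01 c1c.
have xX : x \in X by rewrite /X -(reach_loose _ c0c); exact: looseI.
case/negP; have [h|h] := boolP (coreless (x |: class c j)).
  have mv : move c (recolor c x (Some j)).
    by apply/existsP; exists x; apply/existsP; exists j; rewrite cx eqxx /move_for h /=.
  rewrite -(c1cl _ _ (connect_trans c1c (connect1 mv))).
  apply: (subsetP (cl_ext _)); rewrite inE xX andbT class_recolor// eqxx.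
  exact: setU11.
rewrite -(c1cl _ _ c1c); apply: subsetP (cl_blocker (forallP cP j) h).
by apply: cl_mono; rewrite subsetI blocker_sub /X -(reach_loose _ c0c) blocker_loose.
Qed.

End Colouring.
End Coreless.

Local Open Scope classical_set_scope.
Local Open Scope ring_scope.

(** * Quasi-independence of finite sequences, compactness, generated subgroups *)

Definition qi_seq (V : zmodType) (s : seq V) := forall e : V -> int,
  (forall v, e v \in [:: -1; 0; 1]) -> \sum_(v <- s) v *~ e v = 0 ->
  forall v, v \in s -> e v = 0.

Lemma qi_seqP (V : zmodType) (Q : set V) :
  quasi_independent Q <->
  (forall s, uniq s -> {in s, forall v, Q v} -> qi_seq s).
Proof.
split=> [[Q0 Qe] s us sQ e e01 es v vs|Qs].
  pose e' v := if v \in s then e v else 0.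
  have e'E : \sum_(v \in Q) v *~ e' v = \sum_(v <- s) v *~ e v.
    rewrite (fsbigE s)//; last first.
      by move=> i Qi iNs; rewrite /e' (negPf iNs) mulr0z.
    rewrite [LHS]big_mkcond [RHS]big_seq_cond [LHS]big_seq_cond.
    rewrite [LHS](eq_bigr (fun v => v *~ e v)).
      by apply: eq_bigl => i; rewrite andbT.
    move=> i; rewrite andbT => is_; rewrite /e' is_ ifT//.
    by rewrite inE; exact: sQ.
  have := Qe e'; rewrite e'E => /(_ _ _ es) -/(_ _ _ v (sQ v vs)).
  rewrite /e' vs; apply; first by move=> w; case: ifP.
  apply: (@sub_finite_set _ _ [set` s]); last exact: finite_seq.
  by move=> w /= [_]; case: ifP; rewrite ?eqxx.
split=> [Q0|e e01 fe es v Qv].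
  have /(_ isT (ltac:(by move=> v; rewrite inE => /eqP ->)) (fun=> 1)) := Qs [:: 0].
  rewrite big_seq1 mul0rz => /(_ (fun=> isT) erefl 0).
  by rewrite inE eqxx => /(_ isT).
have [->//|ev] := eqVneq (e v) 0.
pose s := fset_set [set v | Q v /\ e v != 0].
have inS w : (w \in s) = `[< Q w /\ e w != 0 >].
  by rewrite in_fset_set//; apply/idP/asboolP => [/set_mem|/mem_set].
apply: (Qs s (fset_uniq s)) => //.
- by move=> w; rewrite inS => /asboolP[].
- apply: etrans es; rewrite [in RHS](fsbigE s)//; first last.
  + move=> i Qi; rewrite inS => /asboolP/not_andP[//|/negP].
    by rewrite negbK => /eqP ->; rewrite mulr0z.
  + by move=> w /=; rewrite inS => /asboolP[].
  rewrite [RHS]big_mkcond; apply: eq_big_seq => w; rewrite inS => /asboolP[Qw _].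
  by rewrite mem_set.
- by rewrite inS; apply/asboolP.
Qed.

(** The colourings that are good on a finite set A form a filter base as A grows;
    an ultrafilter above it selects one colour for each element. *)
Lemma colouring_compactness (V : choiceType) (m : nat) (L : set V) (P : seq V -> Prop) :
  (forall A : {fset V}, [set` A] `<=` L -> exists c : V -> 'I_m,
     forall j s, uniq s -> {in s, forall v, v \in A /\ c v = j} -> P s) ->
  exists c : V -> 'I_m,
    forall j s, uniq s -> {in s, forall v, L v /\ c v = j} -> P s.
Proof.
move=> fin.
pose good (A : {fset V}) := [set c : V -> 'I_m |
     forall j s, uniq s -> {in s, forall v, v \in A /\ c v = j} -> P s].
pose D := [set A : {fset V} | [set` A] `<=` L].
have FF : ProperFilter (filter_from D good).
  apply: filter_from_proper; last by move=> A /fin[c cP]; exists c.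
  apply: filter_from_filter; first by exists fset0 => /= x.
  move=> A B DA DB; exists (A `|` B)%fset.
    by move=> x /=; rewrite inE => /orP[/DA|/DB].
  move=> c cP; split=> j s us sP; apply: (cP j s us) => v /sP[vA ->];
    by split=> //; rewrite inE vA ?orbT.
have [U [UU FU]] := ultraFilterLemma FF.
have ex v : exists j, U [set c | c v = j].
  apply: contrapT => /forallNP h.
  have : \forall c \near U, forall j, c v <> j.
    apply: filter_forall => j.
    by have [//|] := in_ultra_setVsetC [set c : V -> 'I_m | c v = j] UU; first by move/h.
  by move=> /filter_ex[c /(_ (c v))].
have [c cP] := choice ex.
exists c => j s us sP.
have : \forall d \near U, forall v : seq_sub s, d (val v) = c (val v).
  by apply: filter_forall => v; exact: cP.
have : U (good [fset x in s]%fset).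
  by apply: FU; exists [fset x in s]%fset => //= x; rewrite /= in_fset => /sP[].
move=> Ug Ud; have [d [dg dc]] := filter_ex (filterI Ug Ud).
apply: (dg j s us) => v vs; split; first by rewrite inE.
by rewrite (dc (SeqSub vs)) /=; have [] := sP v vs.
Qed.

Section Generated.
Variables (V : zmodType) (T : finType) (v : T -> V).

Definition subgroup (P : V -> Prop) := P 0 /\ forall x y, P x -> P y -> P (x - y).

Lemma subgroupMz P x k : subgroup P -> P x -> P (x *~ k).
Proof.
move=> [P0 PB] Px; have PN y : P y -> P (- y) by rewrite -sub0r => Py; exact: (PB _ _ P0 Py).
have Pn n : P (x *+ n).
  elim: n => [|n IH]; first by rewrite mulr0n.
  by rewrite mulrSr -[X in _ + X]opprK; apply: (PB) => //; exact: PN.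
by case: k => n; [rewrite -pmulrn|rewrite NegzE mulrNz -pmulrn; exact: PN].
Qed.

Lemma subgroup_sum P I (r : seq I) (p : pred I) (F : I -> V) : subgroup P ->
  (forall i, p i -> P (F i)) -> P (\sum_(i <- r | p i) F i).
Proof.
move=> [P0 PB] PF; apply: big_ind => // x y Px Py.
by rewrite -[y]opprK; apply: (PB) => //; rewrite -sub0r; exact: (PB).
Qed.

(** Quantifying over all subgroups avoids writing combinations; a property of
    characters that is closed under subtraction passes to [generated S] at once. *)
Definition generated (S : {set T}) : {set T} := [set t | `[< forall P, subgroup P ->
  (forall s, s \in S -> P (v s)) -> P (v t) >]]%SET.

Lemma generatedP (S : {set T}) t : reflect (forall P, subgroup P ->
  (forall s, s \in S -> P (v s)) -> P (v t)) (t \in generated S).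
Proof. by rewrite inE; exact: asboolP. Qed.

Lemma generated_ext (S : {set T}) : S \subset generated S.
Proof. by apply/fintype.subsetP => t tS; apply/generatedP => P _; apply. Qed.

Lemma generated_mono (S S' : {set T}) : S \subset S' -> generated S \subset generated S'.
Proof.
move=> /fintype.subsetP SS'; apply/fintype.subsetP => t /generatedP h; apply/generatedP => P sP PS'.
by apply: h => // s /SS'/PS'.
Qed.

Lemma generated_idem (S : {set T}) : generated (generated S) = generated S.
Proof.
apply/eqP; rewrite finset.eqEsubset generated_ext andbT; apply/fintype.subsetP => t /generatedP h.
by apply/generatedP => P sP PS; apply: h => // s /generatedP; apply.
Qed.

(** A nontrivial relation with coefficients 1 and -1 writes each element of its
    support in terms of the others, so its support is a core. *)
Lemma coreless_qi (S : {set T}) (e : T -> int) : coreless generated S ->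
  (forall t, e t \in [:: -1; 0; 1]) -> \sum_(t in S) v t *~ e t = 0 ->
  forall t, t \in S -> e t = 0.
Proof.
move=> /corelessP cS e01 es.
pose C := [set t in S | e t != 0]%SET.
have sC : \sum_(t in C) v t *~ e t = 0.
  apply: etrans es; rewrite [RHS](bigID (fun t => e t != 0))/= [X in _ = _ + X]big1 ?addr0.
    by apply: eq_bigl => t; rewrite inE.
  by move=> t /andP[_]; rewrite negbK => /eqP->; rewrite mulr0z.
suff /cS C0 : core generated C.
  move=> t tS; apply/eqP; apply: contraT => et.
  have : t \in C by rewrite inE tS.
  by rewrite C0 ?inE//; apply/fintype.subsetP => x; rewrite inE => /andP[].
apply/forallP => t; apply/implyP => tC; apply/generatedP => P sP PC.
have vE : v t *~ e t = 0 - \sum_(u in C :\ t) v u *~ e u.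
  by move/eqP: sC; rewrite (big_setD1 t)//= addr_eq0 sub0r => /eqP.
have Pe : P (v t *~ e t).
  rewrite vE; apply: sP.2; first exact: sP.1.
  by apply: subgroup_sum => // u uC; apply: subgroupMz => //; exact: PC.
have := e01 t; rewrite !inE => /or3P[/eqP et|/eqP et|/eqP et].
- by move: Pe; rewrite et mulrN1z => Pe; rewrite -[v t]opprK -sub0r; apply: sP.2 => //; exact: sP.1.
- by move: tC; rewrite inE et eqxx andbF.
- by move: Pe; rewrite et mulr1z.
Qed.
End Generated.

(** * The essential supremum of a continuous function on a compact group *)

(** [cover_compact] is equivalent to [compact] on pointed spaces. *)
Definition pointed_copy (G : topologicalZmodType) : Type := G.
HB.instance Definition _ (G : topologicalZmodType) :=
  Topological.copy (pointed_copy G) G.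
HB.instance Definition _ (G : topologicalZmodType) :=
  isPointed.Build (pointed_copy G) (0 : G).

Section Haar.
Variables (R : realType) (G : topologicalZmodType).
Hypothesis G_compact : compact [set: G].
Variable mu : probability (borelType G) R.
Hypothesis mu_haar : is_haar mu.

Lemma open_borel (U : set G) : open U -> measurable (U : set (borelType G)).
Proof. by move=> oU; exact: sub_sigma_algebra. Qed.

Lemma translateE (x : G) (U : set G) :
  (fun y => x + y) @` U = (fun y => y - x) @^-1` U.
Proof.
apply/seteqP; split=> [_ [y Uy <-]|y Uy] /=; first by rewrite addrC addKr.
by exists (y - x) => //; rewrite addrC subrK.
Qed.

Lemma open_translate (x : G) (U : set G) : open U -> open ((fun y => x + y) @` U).
Proof.
move=> oU; rewrite translateE; apply: open_comp => // y _.
apply: (@continuous_comp G (G * G)%type G (fun y => (y, x)) (fun p => p.1 - p.2)).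
  by apply: cvg_pair; [exact: cvg_id|exact: cvg_cst].
exact: sub_continuous.
Qed.

(** Finitely many translates of U cover G, and they have the same measure. *)
Lemma haar_open_neq0 (U : set G) : open U -> U !=set0 ->
  mu (U : set (borelType G)) != 0%E.
Proof.
move=> oU [u Uu]; apply/eqP => mU.
have : cover_compact [set: pointed_copy G] by rewrite -compact_cover.
move=> /(_ (pointed_copy G) setT (fun x : G => [set x + y | y in U])) [].
- by move=> x _; exact: open_translate.
- by move=> x _; exists (x - u) => //; exists u => //; rewrite subrK.
move=> D _ DT.
have : mu.-negligible (\bigcup_(x in [set` D]) ([set (x : G) + y | y in U] : set (borelType G))).
  rewrite bigcup_fset; apply: big_ind => [|A B|x _].
  - exact: negligible_set0.
  - exact: negligibleU.
  - have mt := open_borel (open_translate x oU).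
    exists [set (x : G) + y | y in U]; split => //.
    by rewrite mu_haar.1//; exact: open_borel.
move=> negD; have /measure_negligible : mu.-negligible [set: borelType G].
  by apply: negligibleS negD; exact: DT.
move=> /(_ measurableT) mu0.
by have [/eqP] := etrans (esym (probability_setT mu)) mu0; rewrite oner_eq0.
Qed.

Lemma normc_lt_ball (a b : R[i]) (r : R) : `|a - b| < (normc a - r)%:C%C -> r < normc b.
Proof.
have -> : `|a - b| = (normc (a - b))%:C%C by [].
rewrite ltcR => h.
have := le_normcD (a - b) b; rewrite subrK; lra.
Qed.

Lemma open_normc_gt (f : G -> (R[i] : numFieldType)) (r : R) : continuous f ->
  open [set x | r < normc (f x)].
Proof.
move=> fc; rewrite openE => x /= rx; rewrite /interior.
have e0 : 0 < (normc (f x) - r)%:C%C :> (R[i] : numFieldType).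
  by rewrite (_ : 0 = (0 : R)%:C%C)// ltcR subr_gt0.
have fx : f y @[y --> x] --> f x by exact: fc.
move/cvgrPdist_lt: fx => /(_ _ e0); apply: filterS => y.
exact: normc_lt_ball.
Qed.

Lemma Loo_normE (f : G -> R[i]) :
  ('N[mu]_(+oo) [(fun x => (normc (f x))%:E)] = ess_sup mu (fun x => (normc (f x))%:E))%E.
Proof.
have mT : mu [set: borelType G] = 1%E := probability_setT mu.
rewrite unlock /= mT lte01; congr (ess_sup mu _); apply/funext => x /=.
by rewrite ger0_norm//; case: (f x) => a b; exact: sqrtr_ge0.
Qed.

Lemma Loo_le (f : G -> R[i]) (B : R) : (forall x, normc (f x) <= B) ->
  ('N[mu]_(+oo) [(fun x => (normc (f x))%:E)] <= B%:E)%E.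
Proof.
by move=> fB; rewrite Loo_normE; apply/ess_supP; apply: nearW => x; rewrite lee_fin.
Qed.

(** The essential supremum of a continuous function bounds it everywhere, as it
    can be exceeded only on an open null set. *)
Lemma le_Loo (f : G -> (R[i] : numFieldType)) x : continuous f ->
  ((normc (f x))%:E <= 'N[mu]_(+oo) [(fun x => (normc (f x))%:E)])%E.
Proof.
move=> fc; rewrite Loo_normE leNgt; apply/negP.
case: (ess_sup _ _) (@ess_sup_ge _ (borelType G) _ mu (fun x => (normc (f x))%:E)) => [r|//|].
- move=> ae; rewrite lte_fin => rx.
  have oU := open_normc_gt r fc; have /eqP := haar_open_neq0 oU (ex_intro _ x rx).
  apply; apply: measure_negligible; first exact: open_borel.
  apply: negligibleS ae => y /= ry; apply/negP; by rewrite lee_fin -ltNge.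
- move=> ae _; have : mu.-negligible [set: borelType G].
    by apply: negligibleS ae => y _ /=; rewrite leeNy_eq.
  move=> /measure_negligible => /(_ measurableT) mu0.
  by have [/eqP] := etrans (esym (probability_setT mu)) mu0; rewrite oner_eq0.
Qed.


End Haar.

(** * Signed sums and values of characters *)

Section SignCount.
Variables (R : realType) (T : finType) (X : {set T}).

(** Bounding exp (-y) by 1 / (1 + y) for y = 2 u^2 - u reduces this to
    1 <= (1 + u) (1 - u + 2 u^2) = 1 + u^2 (1 + 2 u). *)
Lemma expR_le_1D (u : R) : - (1 / 2) <= u -> expR (u - 2 * u ^+ 2) <= 1 + u.
Proof.
move=> u2; have h := expR_ge1Dx (- (u - 2 * u ^+ 2)).
have d0 : 0 < 1 - (u - 2 * u ^+ 2) by nra.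
rewrite -[u - _]opprK expRN; apply: (@le_trans _ _ (1 - (u - 2 * u ^+ 2))^-1).
  by rewrite lef_pV2// posrE ?expR_gt0.
rewrite -[leLHS]mul1r ler_pdivrMr//.
have : 0 <= u ^+ 2 * (1 + 2 * u) by rewrite mulr_ge0 ?sqr_ge0//; lra.
nra.
Qed.

(** A polynomial replacement for the exponential moment of a random signed sum:
    its average over the signs is exactly 1. *)
Definition sign_prod (lam : R) (c : T -> R) (eps : {ffun T -> bool}) :=
  \prod_(t in X) (1 + lam * ((-1) ^+ eps t * c t)).

Lemma sum_sign_prod lam c : \sum_eps sign_prod lam c eps = 2 ^+ #|T|.
Proof.
transitivity (\sum_(eps : {ffun T -> bool})
    \prod_t (if t \in X then 1 + lam * ((-1) ^+ eps t * c t) else 1)).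
  by apply: eq_bigr => eps _; rewrite /sign_prod big_mkcond.
rewrite -(bigA_distr_bigA (fun t (b : bool) =>
  if t \in X then 1 + lam * ((-1) ^+ b * c t) else 1)).
rewrite (eq_bigr (fun=> 2)) ?prodr_const// => t _.
by rewrite big_bool /= expr1 expr0; case: ifP => _; ring.
Qed.

(** Chernoff bound: if every choice of signs has a large inner product with one of
    the vectors c j, then there are exponentially many vectors. *)
Lemma sign_count (J : eqType) (js : seq J) (c : J -> T -> R) (theta : R) :
  0 <= theta <= 1 ->
  (forall j t, `|c j t| <= 1) ->
  (forall eps : {ffun T -> bool}, exists2 j, j \in js &
     theta * #|X|%:R <= \sum_(t in X) (-1) ^+ eps t * c j t) ->
  expR (theta ^+ 2 / 8 * #|X|%:R) <= (size js)%:R.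
Proof.
move=> /andP[th0 th1] c1 big_dev.
(* This value maximises lam theta - 2 lam^2, the exponent gained per element. *)
pose lam := theta / 4.
have u_small j (eps : {ffun T -> bool}) t : `|lam * ((-1) ^+ eps t * c j t)| <= lam.
  rewrite normrM [X in _ * X]normrM normr_sign mul1r ger0_norm ?divr_ge0//.
  by rewrite ler_piMr// divr_ge0.
have prod_ge0 j eps : 0 <= sign_prod lam (c j) eps.
  apply: prodr_ge0 => t _; have := u_small j eps t; rewrite ler_norml => /andP[+ _].
  rewrite /lam; lra.
have prod_big (eps : {ffun T -> bool}) j :
    theta * #|X|%:R <= \sum_(t in X) (-1) ^+ eps t * c j t ->
    expR (theta ^+ 2 / 8 * #|X|%:R) <= sign_prod lam (c j) eps.
  move=> dev.
  apply: (@le_trans _ _ (expR (\sum_(t in X)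
      (lam * ((-1) ^+ eps t * c j t) - 2 * lam ^+ 2)))).
    rewrite ler_expR sumrB -mulr_sumr sumr_const.
    apply: (@le_trans _ _ (lam * (theta * #|X|%:R) - 2 * lam ^+ 2 * #|X|%:R)).
      by rewrite le_eqVlt; apply/orP; left; apply/eqP; rewrite /lam; field.
    by rewrite [2 * lam ^+ 2 * _]mulr_natr lerD2r ler_wpM2l// divr_ge0.
  rewrite expR_sum; apply: ler_prod => t _; rewrite expR_ge0 /=.
  have := u_small j eps t; set u := lam * _ => ul.
  apply: le_trans (expR_le_1D _).
    rewrite ler_expR lerD2l lerN2 ler_wpM2l//.
    by rewrite -(ger0_norm (sqr_ge0 u)) normrX; apply: lerXn2r; rewrite // nnegrE// divr_ge0.
  by move: ul; rewrite ler_norml => /andP[+ _]; rewrite /lam; lra.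
have two0 : 0 < 2 ^+ #|T| :> R by rewrite exprn_gt0.
rewrite -(ler_pM2r two0).
have -> : (size js)%:R * 2 ^+ #|T| = \sum_(eps : {ffun T -> bool})
    \sum_(j <- js) sign_prod lam (c j) eps.
  rewrite exchange_big /= (eq_bigr (fun=> 2 ^+ #|T|)); last by move=> j _; exact: sum_sign_prod.
  by rewrite big_const_seq count_predT iter_addr_0 mulr_natl.
have -> : expR (theta ^+ 2 / 8 * #|X|%:R) * 2 ^+ #|T| =
    \sum_(eps : {ffun T -> bool}) expR (theta ^+ 2 / 8 * #|X|%:R).
  by rewrite sumr_const card_ffun card_bool -natrX mulr_natr.
apply: ler_sum => eps _; have [j jjs /prod_big h] := big_dev eps.
by apply: le_trans h _; rewrite (big_rem j)//= lerDl sumr_ge0.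
Qed.

End SignCount.

Section Characters.
Variables (R : realType) (G : topologicalZmodType).
Local Notation V := (dual_group R G).
Implicit Types (g h : V) (x y : G).

Lemma dualD g h x : (g + h) x = g x * h x. Proof. by []. Qed.
Lemma dual0 x : (0 : V) x = 1. Proof. by []. Qed.
Lemma dualN g x : (- g) x = (g x)^-1. Proof. by []. Qed.

Lemma dualMn g n x : (g *+ n) x = g x ^+ n.
Proof. by elim: n => [|n IH]; rewrite ?mulr0n// mulrS dualD IH exprS. Qed.

Lemma dual_sum I (r : seq I) (P : pred I) (F : I -> V) x :
  (\sum_(i <- r | P i) F i) x = \prod_(i <- r | P i) F i x.
Proof. by apply: (big_morph (fun g : V => g x)). Qed.

Lemma subgroup_eq_at x y : subgroup (fun g : V => g x = g y).
Proof. by split=> // g h gE hE; rewrite !dualD !dualN gE hE. Qed.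

Lemma normc_dual g x : normc (g x) = 1.
Proof.
have h : (normc (g x))%:C%C = 1 :> R[i] by exact: (dual_fun_norm g x).
by case: h.
Qed.

Lemma roots_of_unity (N : nat) : (0 < N)%N ->
  exists2 rs : seq R[i], size rs = N & forall z, z ^+ N = 1 -> z \in rs.
Proof.
move=> N0; have [rs rsE] := closed_field_poly_normal ('X^N - 1 : {poly R[i]}).
have mon : lead_coef ('X^N - 1 : {poly R[i]}) = 1 by rewrite -polyC1 lead_coefXnsubC.
move: rsE; rewrite mon scale1r => rsE; exists rs.
  by have := congr1 (fun p : {poly R[i]} => size p) rsE; rewrite size_XnsubC// size_prod_XsubC => -[].
move=> z zN; rewrite -root_prod_XsubC -rsE rootE !hornerE zN.
by rewrite subrr.
Qed.

(** The values at x of the characters in s are N-th roots of unity, so there are at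
    most N ^ size s possible lists of values; one point is kept for each. *)
Lemma separating_points (N : nat) : (0 < N)%N -> (forall g : V, g *+ N = 0) ->
  forall s : seq V, exists pts : seq G, (size pts <= N ^ size s)%N /\
    forall x, exists2 y, y \in pts & {in s, forall g, g x = g y}.
Proof.
move=> N0 tors; have [rs rsN rsP] := roots_of_unity N0.
elim=> [|g s [pts [ptsN ptsP]]]; first by exists [:: 0]; split=> // x; exists 0; rewrite ?inE.
pose sel (p : G * R[i]) := xget 0 [set x | g x = p.2 /\ {in s, forall h, h x = h p.1}].
exists [seq sel (y, r) | y <- pts, r <- rs]; split.
  by rewrite size_allpairs rsN expnSr leq_mul2r ptsN orbT.
move=> x; have [y yp xy] := ptsP x.
have gr : g x \in rs by apply: rsP; rewrite -dualMn tors.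
exists (sel (y, g x)); first by apply/allpairsP; exists (y, g x).
have [gs ss] : [set z | g z = g x /\ {in s, forall h, h z = h y}] (sel (y, g x)).
  by apply: xgetPex; exists x.
by move=> h; rewrite inE => /predU1P[->|hs]; rewrite ?gs// ss// xy.
Qed.

End Characters.

(** * Colouring finite subsets of a Sidon set *)

Section Forward.
Variables (R : realType) (G : topologicalZmodType).
Local Notation V := (dual_group R G).
Variables (L : set V) (S : R) (N : nat).

(** B stands for the supremum of the modulus of the polynomial. *)
Definition sidon_pointwise := forall (F : {fset V}) (a : V -> R[i]) (B : R),
  [set` F] `<=` L -> (forall x, normc (\sum_(g <- F) a g * g x) <= B) ->
  \sum_(g <- F) normc (a g) <= S * B.

Hypothesis L0 : ~ L 0.
Hypothesis S1 : 1 <= S.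
Hypothesis sid : sidon_pointwise.
Hypothesis N0 : (0 < N)%N.
Hypothesis tors : forall g : V, g *+ N = 0.

Lemma sidon_family (T : finType) (v : T -> V) (X : {set T}) (a : T -> R[i]) (B : R) :
  injective v -> (forall t, t \in X -> L (v t)) ->
  (forall x, normc (\sum_(t in X) a t * v t x) <= B) ->
  \sum_(t in X) normc (a t) <= S * B.
Proof.
move=> vI XL fB.
pose F := [fset v t | t in X]%fset.
pose b g := if [pick t | v t == g] is Some t then a t else 0.
have bE t : b (v t) = a t.
  by rewrite /b; case: pickP => [u /eqP/vI -> //|/(_ t)]; rewrite eqxx.
have -> : \sum_(t in X) normc (a t) = \sum_(g <- F) normc (b g).
  rewrite big_imfset /=; last by move=> x y _ _ /vI.
  by rewrite big_enum; apply: eq_bigr => t _; rewrite bE.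
apply: sid => [g /= /imfsetP[t /= tX ->]|x]; first exact: XL.
rewrite big_imfset /=; last by move=> y z _ _ /vI.
rewrite big_enum /=; under eq_bigr do rewrite bE; exact: fB.
Qed.

Lemma normc_le_ReIm (z : R[i]) : normc z <= `|complex.Re z| + `|complex.Im z|.
Proof.
case: z => a b /=; rewrite -(@ler_pXn2r _ 2)// ?nnegrE ?sqrtr_ge0 ?addr_ge0//.
rewrite sqr_sqrtr ?addr_ge0 ?sqr_ge0// -[a ^+ 2]real_normK ?num_real//.
rewrite -[b ^+ 2]real_normK ?num_real//.
have : 0 <= `|a| * `|b| by rewrite mulr_ge0.
nra.
Qed.

Lemma le_normcRe (z : R[i]) : `|complex.Re z| <= normc z.
Proof. by rewrite -lecR; exact: normc_ge_Re. Qed.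

Lemma le_normcIm (z : R[i]) : `|complex.Im z| <= normc z.
Proof.
case: z => a b /=; rewrite -sqrtr_sqr ler_sqrt ?lerDr ?sqr_ge0//.
by rewrite addr_ge0 ?sqr_ge0.
Qed.

(** A subset of a Sidon set is not generated by many fewer elements.  For each
    choice of signs the Sidon inequality gives a point where the signed sum over
    X exceeds #|X| / (2 S), and a point may be replaced by any other one at which
    the characters in Y, hence those in X, take the same values. *)
Lemma spanned_size (T : finType) (v : T -> V) (X Y : {set T}) :
  injective v -> (forall t, t \in X -> L (v t)) ->
  X != finset.set0 -> X \subset generated v Y ->
  expR (((4 * S)^-1) ^+ 2 / 8 * #|X|%:R) <= (4 * N ^ #|Y|)%:R :> R.
Proof.
move=> vI XL X0 XY.
have [pts [ptsN ptsP]] := separating_points N0 tors [seq v t | t in Y].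
(* The two booleans choose a sign, and the real or the imaginary part. *)
pose js := [seq (y, b) | y <- pts, b <- enum {: bool * bool}].
have js_size : (size js <= 4 * N ^ #|Y|)%N.
  rewrite size_allpairs -cardE card_prod card_bool mulnC leq_mul2l /=.
  by move: ptsN; rewrite size_map -cardE.
apply: (@le_trans _ _ (size js)%:R); last by rewrite ler_nat.
pose c (j : G * (bool * bool)) t := (-1) ^+ j.2.1 *
  (if j.2.2 then complex.Im (v t j.1) else complex.Re (v t j.1)).
have S0 : 0 < S by exact: lt_le_trans ltr01 S1.
have n0 : 0 < #|X|%:R :> R by rewrite ltr0n card_gt0.
apply: (@sign_count R T X _ js c).
- have S4 : 1 <= 4 * S by rewrite (le_trans S1)// ler_peMl ?(ltW S0)// ler1n.
  by rewrite invr_ge0 (le_trans ler01 S4) invf_le1// (lt_le_trans ltr01 S4).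
- move=> [y [b1 b2]] t; rewrite /c /= normrM normr_sign mul1r -(normc_dual (v t) y).
  by case: b2; [exact: le_normcIm|exact: le_normcRe].
move=> eps.
have [x xbig] : exists x, #|X|%:R / (2 * S) <
    normc (\sum_(t in X) (-1) ^+ eps t * v t x).
  apply: contrapT => /forallNP small.
  have : \sum_(t in X) normc ((-1) ^+ eps t : R[i]) <= S * (#|X|%:R / (2 * S)).
    apply: (@sidon_family T v X (fun t => (-1) ^+ eps t)) => // x.
    by rewrite leNgt; apply/negP/small.
  rewrite (eq_bigr (fun=> 1)); last first.
    by move=> t _; case: (eps t); rewrite ?expr1 ?expr0 ?normcN normc1.
  rewrite sumr_const (_ : S * _ = #|X|%:R / 2); first by move: n0; lra.
  by field; rewrite gt_eqF.
have [y yp xy] := ptsP x.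
have vxy t : t \in X -> v t x = v t y.
  move=> tX; have /generatedP tY := fintype.subsetP XY _ tX.
  apply: (tY (fun g : V => g x = g y)); first exact: subgroup_eq_at.
  by move=> s sY; apply: xy; apply/mapP; exists s; rewrite ?mem_enum.
have {xbig} : #|X|%:R / (2 * S) < normc (\sum_(t in X) (-1) ^+ eps t * v t y).
  rewrite (eq_bigr (fun t => (-1) ^+ eps t * v t x))// => t tX.
  by rewrite vxy.
set z := \sum_(t in X) _ => zbig.
have sgnRe (b : bool) (w : R[i]) : complex.Re ((-1) ^+ b * w) = (-1) ^+ b * complex.Re w.
  by case: b; rewrite ?expr1 ?expr0 ?mulN1r ?mul1r//; case: (w).
have sgnIm (b : bool) (w : R[i]) : complex.Im ((-1) ^+ b * w) = (-1) ^+ b * complex.Im w.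
  by case: b; rewrite ?expr1 ?expr0 ?mulN1r ?mul1r//; case: (w).
have ReE : \sum_(t in X) (-1) ^+ eps t * complex.Re (v t y) = complex.Re z.
  rewrite /z (big_morph (@complex.Re R) (id1 := 0) (op1 := +%R)) => [||//]; last by case=> ? ? [].
  by apply: eq_bigr => t _; rewrite sgnRe.
have ImE : \sum_(t in X) (-1) ^+ eps t * complex.Im (v t y) = complex.Im z.
  rewrite /z (big_morph (@complex.Im R) (id1 := 0) (op1 := +%R)) => [||//]; last by case=> ? ? [].
  by apply: eq_bigr => t _; rewrite sgnIm.
have half : #|X|%:R / (2 * S) = (4 * S)^-1 * #|X|%:R + (4 * S)^-1 * #|X|%:R.
  by field; rewrite gt_eqF.
have := lt_le_trans zbig (normc_le_ReIm z); rewrite half.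
have [Rebig _|Resmall] := leP ((4 * S)^-1 * #|X|%:R) `|complex.Re z|.
  exists (y, (complex.Re z < 0, false)).
    by apply/allpairsP; exists (y, (complex.Re z < 0, false)); rewrite mem_enum.
  rewrite (eq_bigr (fun t => (-1) ^+ (complex.Re z < 0)%R * ((-1) ^+ eps t * complex.Re (v t y)))).
    by rewrite -mulr_sumr ReE -normrEsign.
  by move=> t _; rewrite /c /= mulrCA.
move=> Imbig; exists (y, (complex.Im z < 0, true)).
  by apply/allpairsP; exists (y, (complex.Im z < 0, true)); rewrite mem_enum.
rewrite (eq_bigr (fun t => (-1) ^+ (complex.Im z < 0)%R * ((-1) ^+ eps t * complex.Im (v t y)))).
  by rewrite -mulr_sumr ImE -normrEsign; lra.
by move=> t _; rewrite /c /= mulrCA.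
Qed.

(** If a nonempty X contained m disjoint generating sets, the smallest of them, Y,
    would give exp (kappa m #|Y|) <= 4 N ^ #|Y|, which is false for large m. *)
Lemma sidon_colouring : exists m : nat, forall A : {fset V}, [set` A] `<=` L ->
  exists c : V -> 'I_m, forall j s, uniq s ->
    {in s, forall g, g \in A /\ c g = j} -> qi_seq s.
Proof.
pose kappa : R := ((4 * S)^-1) ^+ 2 / 8.
have S0 : 0 < S by exact: lt_le_trans ltr01 S1.
have k0 : 0 < kappa by rewrite divr_gt0// exprn_gt0// invr_gt0 mulr_gt0.
pose m0 := Num.bound ((4 * N)%:R / kappa).
have m0P : (4 * N)%:R / kappa < m0%:R.
  by rewrite archi_boundP// divr_ge0 ?ler0n ?(ltW k0).
have mbig : (4 * N)%:R < expR (kappa * m0%:R).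
  have := expR_ge1Dx (kappa * m0%:R).
  by move: m0P; rewrite ltr_pdivrMr// mulrC => h; apply: lt_le_trans; lra.
have m00 : (0 < m0)%N.
  by rewrite -(ltr0n R); apply: le_lt_trans m0P; rewrite divr_ge0 ?ler0n ?(ltW k0).
exists m0 => A AL; pose v (t : A) : V := val t.
have vL t : L (v t) by apply: AL; exact: valP.
have [X c X0|c cP] := @coreless_colouring _ (generated v) (generated_ext v)
    (@generated_mono _ _ v) (generated_idem v) m0.
  (* One of the m0 disjoint sets has at most #|X| / m0 elements. *)
  have [j jP] : exists j, (m0 * #|class c j :&: X| <= #|X|)%N.
    apply: contrapT => /forallNP big.
    have : (\sum_j #|class c j :&: X| <= #|X|)%N.
      rewrite -sum1_card [X in (_ <= X)%N]big_mkcond /=.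
      rewrite (eq_bigr (fun j => (\sum_t (t \in class c j :&: X))%N)); last first.
        by move=> j _; rewrite -sum1_card big_mkcond.
      rewrite exchange_big /=; apply: leq_sum => t _.
      case: ifP => tX; last by rewrite big1// => j _; rewrite inE tX andbF.
      case ct : (c t) => [j0|]; last by rewrite big1// => j _; rewrite !inE ct.
      rewrite (bigD1 j0)//= big1 ?addn0 ?leq_b1// => j jj0.
      by rewrite !inE ct; case: eqP => // -[j0j]; rewrite j0j eqxx in jj0.
    apply/negP; rewrite -ltnNge -(ltn_pmul2l m00) big_distrr /=.
    apply: (@leq_trans (\sum_(j < m0) #|X|.+1)); last first.
      by apply: leq_sum => j _; rewrite ltnNge; apply/negP/big.
    by rewrite sum_nat_const card_ord ltn_pmul2l.
  exists j; apply/negP => XY.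
  have Y0 : (0 < #|class c j :&: X|)%N.
    rewrite lt0n cards_eq0; apply: contraTneq XY => ->.
    have /set0Pn[t tX] := X0; apply/negP => /fintype.subsetP/(_ t tX)/generatedP.
    move=> /(_ (fun g => g = 0)) gP; have : v t = 0.
      apply: gP; first by split=> // x y -> ->; rewrite subr0.
      by move=> s; rewrite inE.
    by move=> vt; apply: L0; rewrite -vt; exact: vL.
  have := @spanned_size _ v X _ val_inj (fun t _ => vL t) X0 XY.
  set Y := class c j :&: X in jP Y0 *.
  apply/negP; rewrite -ltNge.
  apply: (@le_lt_trans _ _ ((4 * N)%:R ^+ #|Y|)).
    rewrite -natrX ler_nat expnMn leq_mul2r; apply/orP; right.
    by rewrite -[X in (X <= _)%N]expn1 leq_exp2l.
  apply: (@lt_le_trans _ _ (expR (kappa * m0%:R) ^+ #|Y|)).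
    by rewrite ltr_pXn2r// nnegrE ?expR_ge0.
  rewrite -expRM_natl ler_expR -/kappa mulrCA ler_wpM2l ?(ltW k0)//.
  by rewrite -natrM ler_nat mulnC.
have [->|A0] := eqVneq A fset0.
  have ord0 : 'I_m0 by exists 0%N.
  exists (fun=> ord0) => j [|g s] _ sP; last by have [] := sP g (mem_head _ _).
  by [].
have [g0 g0A] := fset0Pn _ A0.
pose d g : 'I_m0 := c (odflt [` g0A]%fset (insub g)).
exists d => j s us sP e e01 es.
have cE t : d (v t) = c t by rewrite /d valK.
have := @coreless_qi _ _ v _ (fun t => if v t \in s then e (v t) else 0) (cP j).
move=> qi g gs.
have [gA dg] := sP g gs.
have := qi _ _ [` gA]%fset; rewrite /v /= gs inE; apply.
- by move=> t; case: ifP.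
- rewrite (eq_bigr (fun t => if v t \in s then v t *~ e (v t) else 0)); last first.
    by move=> t _; case: ifP => //; rewrite mulr0z.
  rewrite -big_mkcondr /=; apply: etrans es.
  have ps : perm_eq s [seq v t | t <- enum {: A} & v t \in s].
    apply: uniq_perm => // [|h].
      by rewrite map_inj_uniq; [rewrite filter_uniq// enum_uniq|exact: val_inj].
    apply/idP/mapP => [hs|[t]]; last by rewrite mem_filter => /andP[+ _] ->.
    have [hA _] := sP h hs; exists [` hA]%fset => //.
    by rewrite mem_filter mem_enum /v /= hs.
  rewrite (perm_big _ ps) big_map big_filter big_enum_cond /=.
  apply: eq_bigl => t; rewrite inE; apply: andb_idl => ts.
  by have [_ <-] := sP _ ts; rewrite cE.
- by rewrite -cE /v /= dg.
Qed.


End Forward.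

(** * Riesz products *)

Section Means.
Variables (R : realType) (G : topologicalZmodType).
Local Notation V := (dual_group R G).
Local Notation C := R[i].
Variable N : nat.
Hypothesis N0 : (0 < N)%N.
Hypothesis tors : forall g : V, g *+ N = 0.

Lemma dual_eq0P (g : V) : (forall x, g x = 1) -> g = 0.
Proof. by move=> g1; apply: dual_eq => x; rewrite g1. Qed.

Lemma dual_multiple (g : V) x n : g (x *+ n) = g x ^+ n.
Proof.
have g0 : g 0 = 1.
  have := dual_funD g 0 0; rewrite addr0 => /esym/eqP.
  by rewrite -[X in _ == X]mulr1 (inj_eq (mulfI (dual_fun_neq0 g 0))) => /eqP.
by elim: n => [|n IH]; rewrite ?mulr0n// mulrS dual_funD IH exprS.
Qed.

Lemma sum_unity_root (z : C) : z ^+ N = 1 -> z != 1 -> \sum_(k < N) z ^+ k = 0.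
Proof.
move=> zN z1; have /eqP := subrX1 z N; rewrite zN subrr eq_sym mulf_eq0 subr_eq0.
by rewrite (negPf z1) => /eqP.
Qed.

(** Finite averages do the work of the Haar integral: averaging over the multiples
    of a point y where g y != 1 kills g, and the average already built is merely
    multiplied by a constant on each other character. *)
Lemma averaging_points (s : seq V) : exists pts : seq G, (0 < size pts)%N /\
  {in s, forall g : V, g != 0 -> \sum_(x <- pts) g x = 0}.
Proof.
elim: s => [|g s [pts [pts0 ptsP]]]; first by exists [:: 0].
have [g0|gN0] := eqVneq g 0.
  exists pts; split=> // h; rewrite inE => /predU1P[->|/ptsP//].
  by rewrite g0 eqxx.
have [y gy] : exists y, g y != 1.
  apply: contrapT => /forallNP h; move/eqP: gN0; apply; apply: dual_eq0P => x.
  by have /negP := h x; rewrite negbK => /eqP.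
exists [seq x + y *+ k | x <- pts, k <- index_iota 0 N]; split.
  by rewrite size_allpairs size_iota subn0 muln_gt0 pts0.
have sumE (h : V) : \sum_(x <- [seq x + y *+ k | x <- pts, k <- index_iota 0 N]) h x =
    (\sum_(x <- pts) h x) * \sum_(k < N) h y ^+ k :> C.
  rewrite big_allpairs_dep mulr_suml; apply: eq_bigr => x _.
  rewrite big_mkord mulr_sumr; apply: eq_bigr => k _.
  by rewrite dual_funD dual_multiple.
move=> h; rewrite inE sumE => /predU1P[->|hs] h0.
  by rewrite (sum_unity_root _ gy) ?mulr0// -dualMn tors.
by rewrite (ptsP h hs h0) mul0r.
Qed.

End Means.

Section Riesz.
Variables (R : realType) (G : topologicalZmodType).
Local Notation V := (dual_group R G).
Local Notation C := R[i].
Variables (T : finType) (v : T -> V).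

(** The elements 0, 1, 2 of 'I_3 encode the coefficients 0, 1, -1. *)
Definition sign3 (k : 'I_3) : int := match nat_of_ord k with 0%N => 0 | 1%N => 1 | _ => -1 end.
Definition coef3 (w : C) (k : 'I_3) : C :=
  match nat_of_ord k with 0%N => 1 | 1%N => w | _ => w^* end.
Local Notation choice3 := {ffun T -> 'I_3}.
Definition signed_sum (e : choice3) : V := \sum_t v t *~ sign3 (e t).
Definition riesz_coef (w : T -> C) (e : choice3) := \prod_t coef3 (w t) (e t).
Definition riesz (w : T -> C) (x : G) : C := \prod_t (1 + w t * v t x + (w t * v t x)^*).

Lemma dual_conj (g : V) x : (g x : C)^* = (g x)^-1.
Proof. by rewrite invC_norm (dual_fun_norm g x) expr1n invr1 mul1r. Qed.

Lemma riesz_expand w x : riesz w x = \sum_e riesz_coef w e * signed_sum e x.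
Proof.
rewrite /riesz (eq_bigr (fun t => \sum_(k < 3) coef3 (w t) k * (v t *~ sign3 k) x)).
  rewrite bigA_distr_bigA /=; apply: eq_bigr => e _.
  by rewrite big_split /= -dual_sum.
move=> t _; rewrite !big_ord_recl big_ord0 addr0 /coef3 /sign3 /=.
by rewrite mulr1z mulr1n mulr1 rmorphM /= dual_conj addrA.
Qed.

Lemma riesz_factor_ge0 (z : C) : `|z| <= 1 / 2 -> 0 <= 1 + z + z^*.
Proof.
move=> z2.
have -> : 1 + z + z^* = `|1 + 2 * z| ^+ 2 / 2 + (1 / 2 - 2 * `|z| ^+ 2).
  by rewrite !normCK rmorphD rmorphM /= rmorph1 rmorph_nat; field.
rewrite addr_ge0 ?divr_ge0 ?exprn_ge0// subr_ge0.
apply: (@le_trans _ _ (2 * (1 / 2) ^+ 2)).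
  by rewrite ler_wpM2l// lerXn2r ?nnegrE// divr_ge0.
by rewrite le_eqVlt; apply/orP; left; apply/eqP; field.
Qed.

Lemma riesz_ge0 w x : (forall t, `|w t| <= 1 / 2) -> 0 <= riesz w x.
Proof.
move=> w2; apply: prodr_ge0 => t _; apply: riesz_factor_ge0.
by rewrite normrM (dual_fun_norm (v t) x) mulr1.
Qed.

Hypothesis qi : forall e, signed_sum e = 0 -> e = [ffun=> ord0].

Variable pts : seq G.
Hypothesis pts0 : (0 < size pts)%N.
Definition mean (f : G -> C) : C := (size pts)%:R^-1 * \sum_(x <- pts) f x.

Lemma mean1 : mean (fun=> 1) = 1.
Proof.
rewrite /mean big_const_seq count_predT iter_addr_0 mulVf//.
by rewrite pnatr_eq0 -lt0n.
Qed.

Lemma mean_sum I (r : seq I) (F : I -> G -> C) :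
  mean (fun x => \sum_(i <- r) F i x) = \sum_(i <- r) mean (F i).
Proof. by rewrite /mean exchange_big mulr_sumr. Qed.

Lemma meanZ (k : C) f : mean (fun x => k * f x) = k * mean f.
Proof. by rewrite /mean -mulr_sumr mulrCA. Qed.

Lemma mean_bound (f p : G -> C) (B : C) : (forall x, `|f x| <= B) ->
  (forall x, 0 <= p x) -> `|mean (fun x => f x * p x)| <= B * mean p.
Proof.
move=> fB p0; rewrite /mean normrM ger0_norm ?invr_ge0// mulrCA.
rewrite ler_wpM2l ?invr_ge0//; apply: le_trans (ler_norm_sum _ _ _) _.
rewrite mulr_sumr; apply: ler_sum => x _.
by rewrite normrM (ger0_norm (p0 x)) ler_wpM2r.
Qed.

Definition mean_kills (g : V) := g != 0 -> mean g = 0.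

Lemma mean_char (g : V) : mean_kills g -> mean g = (g == 0)%:R.
Proof.
rewrite /mean_kills; have [->|_] := eqVneq g 0; last by apply.
by rewrite -mean1.
Qed.

Lemma mean_char_riesz (g : V) w : (forall e, mean_kills (g + signed_sum e)) ->
  mean (fun x => g x * riesz w x) =
  \sum_(e | g + signed_sum e == 0) riesz_coef w e.
Proof.
move=> kills.
transitivity (mean (fun x => \sum_e riesz_coef w e * (g + signed_sum e) x)).
  congr (_ * _); apply: eq_bigr => x _; rewrite riesz_expand mulr_sumr.
  by apply: eq_bigr => e _; rewrite mulrCA.
rewrite mean_sum [RHS]big_mkcond; apply: eq_bigr => e _.
by rewrite meanZ mean_char//; case: ifP => _; rewrite ?mulr1 ?mulr0.
Qed.

(** By quasi-independence only the zero choice of signs contributes. *)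
Lemma mean_riesz w : (forall e, mean_kills (signed_sum e)) -> mean (riesz w) = 1.
Proof.
move=> kills.
have := @mean_char_riesz 0 w; rewrite (_ : mean _ = mean (riesz w)); last first.
  by congr (_ * _); apply: eq_bigr => x _; rewrite dual0 mul1r.
move=> -> => [|e]; last by rewrite add0r.
rewrite (big_pred1 [ffun=> ord0]) => [|e].
  by rewrite /riesz_coef big1// => t _; rewrite ffunE.
rewrite add0r; apply/eqP/eqP => [/qi//|->].
by rewrite /signed_sum big1// => t _; rewrite ffunE mulr0z.
Qed.

Lemma riesz_coef_norm (w : T -> C) (e : choice3) :
  `|riesz_coef w e| = \prod_(t | e t != ord0) `|w t|.
Proof.
rewrite /riesz_coef normr_prod [RHS]big_mkcond; apply: eq_bigr => t _.
by case: (e t) => -[|[|[|//]]] lt3; rewrite /coef3 /= ?normr1 ?norm_conjC.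
Qed.

(** The sum is the correlation of g with the Riesz product of parameters 1/2, which
    is nonnegative and has mean 1. *)
Lemma sum_half (g : V) : (forall e, mean_kills (signed_sum e)) ->
  (forall e, mean_kills (g + signed_sum e)) ->
  \sum_(e | g + signed_sum e == 0) \prod_(t | e t != ord0) (1 / 2 : C) <= 1.
Proof.
move=> kills killsg; pose w : T -> C := fun=> 1 / 2.
have w2 t : `|w t| <= 1 / 2 by rewrite ger0_norm ?divr_ge0.
have cE e : riesz_coef w e = \prod_(t | e t != ord0) (1 / 2 : C).
  rewrite /riesz_coef [RHS]big_mkcond; apply: eq_bigr => t _.
  case: (e t) => -[|[|[|//]]] lt3; rewrite /coef3 //=.
  by rewrite fmorph_div rmorph1 rmorph_nat.
rewrite -(eq_bigr _ (fun e _ => cE e)) -mean_char_riesz//.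
apply: le_trans (real_ler_norm _) _.
  rewrite mean_char_riesz// (eq_bigr _ (fun e _ => cE e)); apply: ger0_real.
  by apply: sumr_ge0 => e _; apply: prodr_ge0 => t _; rewrite divr_ge0.
apply: le_trans (@mean_bound _ (riesz w) 1 _ _) _ => [x|x|].
- by rewrite (dual_fun_norm g x).
- exact: riesz_ge0.
- by rewrite mean_riesz// mulr1.
Qed.

Definition single (t : T) (k : 'I_3) : choice3 := [ffun u => if u == t then k else ord0].
Definition plus3 : 'I_3 := inord 1.
Definition minus3 : 'I_3 := inord 2.

Lemma signed_sum_single t k : signed_sum (single t k) = v t *~ sign3 k.
Proof.
rewrite /signed_sum (bigD1 t)//= ffunE eqxx big1 ?addr0// => u ut.
by rewrite ffunE (negPf ut) mulr0z.
Qed.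

Lemma riesz_coef_single w t k : riesz_coef w (single t k) = coef3 (w t) k.
Proof.
rewrite /riesz_coef (bigD1 t)//= ffunE eqxx big1 ?mulr1// => u ut.
by rewrite ffunE (negPf ut).
Qed.

(** Coefficients of [test] below.  Adding i times the product of parameters i w to
    the one of parameters w cancels the terms of first order along v t and keeps
    those along - v t, so that an element and its opposite in the spectrum are
    told apart. *)
Definition test_coef (w : T -> C) (e : choice3) : C :=
  riesz_coef w e + 'i * riesz_coef (fun t => 'i * w t) e.

Lemma test_coef_plus w t : test_coef w (single t plus3) = 0.
Proof.
rewrite /test_coef !riesz_coef_single /coef3 /plus3 inordK//=.
by rewrite mulrA -expr2 sqrCi mulN1r subrr.
Qed.

Lemma test_coef_minus w t : test_coef w (single t minus3) = 2 * (w t)^*.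
Proof.
rewrite /test_coef !riesz_coef_single /coef3 /minus3 inordK//=.
by rewrite rmorphM /= conjCi mulrA mulrN -expr2 sqrCi opprK mul1r mulr_natl.
Qed.

(** With at least two factors, d^2 can be taken out and what is left is the
    coefficient for the parameters 1/2. *)
Lemma test_coef_small (d : C) (w : T -> C) (e : choice3) : 0 <= d <= 1 ->
  (forall t, `|w t| = d / 2) -> (1 < #|[set t | e t != ord0]%SET|)%N ->
  `|test_coef w e| <= 2 * d ^+ 2 * \prod_(t | e t != ord0) (1 / 2 : C).
Proof.
move=> /andP[d0 d1] wE e2.
have small (w' : T -> C) : (forall t, `|w' t| = d / 2) ->
    `|riesz_coef w' e| <= d ^+ 2 * \prod_(t | e t != ord0) (1 / 2 : C).
  move=> w'E; rewrite riesz_coef_norm [leLHS](eq_bigr (fun=> d * (1 / 2))); last first.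
    by move=> t _; rewrite w'E mul1r.
  rewrite big_split /=; apply: ler_wpM2r.
    by apply: prodr_ge0 => t _; rewrite divr_ge0.
  rewrite prodr_const; apply: ler_wiXn2l => //.
  by move: e2; rewrite cardsE.
rewrite /test_coef; apply: le_trans (ler_normD _ _) _.
rewrite normrM normCi [X in _ + X <= _]mul1r -mulrA mulr_natl mulr2n.
apply: lerD; first exact: small.
apply: small => t.
by rewrite normrM normCi mul1r.
Qed.

Definition test (w : T -> C) x : C := riesz w x + 'i * riesz (fun t => 'i * w t) x.

Lemma mean_char_test (g : V) w : (forall e, mean_kills (g + signed_sum e)) ->
  mean (fun x => g x * test w x) = \sum_(e | g + signed_sum e == 0) test_coef w e.
Proof.
move=> kills; rewrite /test_coef big_split /= -mulr_sumr -!mean_char_riesz//.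
rewrite -meanZ /mean -mulrDr -big_split /=; congr (_ * _).
by apply: eq_bigr => x _; rewrite mulrDr mulrCA.
Qed.

(** Up to an error of order d^2, the test function sees g only if g is one of the
    v t, in which case the sum has a single term. *)
Lemma mean_char_test_approx (g : V) (d : C) (w : T -> C) : 0 <= d <= 1 ->
  (forall t, `|w t| = d / 2) -> g != 0 -> (forall e, mean_kills (signed_sum e)) ->
  (forall e, mean_kills (g + signed_sum e)) ->
  `|mean (fun x => g x * test w x) - \sum_(t | v t == g) 2 * (w t)^*| <= 2 * d ^+ 2.
Proof.
move=> d01 wE g0 kills killsg; rewrite mean_char_test//.
pose neg := [set single t minus3 | t : T]%SET.
have -> : \sum_(t | v t == g) 2 * (w t)^* =
    \sum_(e | (g + signed_sum e == 0) && (e \in neg)) test_coef w e.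
  under [RHS]eq_bigl do rewrite andbC.
  rewrite /neg big_imset_cond => [|t u _ _]; last first.
    move=> /ffunP/(_ t); rewrite !ffunE eqxx; case: eqP => // _.
    by move=> /(congr1 val); rewrite /= inordK.
  apply: eq_big => [t|t _]; last by rewrite test_coef_minus.
  by rewrite signed_sum_single /sign3 inordK//= mulrN1z subr_eq0 eq_sym.
rewrite (bigID (mem neg)) /= addrAC subrr add0r.
have d0 : 0 <= 2 * d ^+ 2 by case/andP: d01 => d0 _; rewrite mulr_ge0// exprn_ge0.
apply: le_trans (ler_norm_sum _ _ _) _.
rewrite -[leRHS]mulr1; apply: le_trans (ler_wpM2l d0 (sum_half kills killsg)).
rewrite mulr_sumr [leRHS](bigID (mem neg)) /=.
apply: ler_wpDl.
  apply: sumr_ge0 => e _; rewrite mulr_ge0//.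
  by apply: prodr_ge0 => t _; rewrite divr_ge0.
apply: ler_sum => e /andP[/eqP ge eneg].
have [e2|] := ltnP 1 #|[set t | e t != ord0]%SET|; first exact: test_coef_small.
have rhs0 : 0 <= 2 * d ^+ 2 * \prod_(t | e t != ord0) (1 / 2 : C).
  by rewrite mulr_ge0// prodr_ge0// => t _; rewrite divr_ge0.
rewrite leq_eqVlt ltnS leqn0 => /orP[/cards1P[t et]|]; last first.
  rewrite cards_eq0 => /eqP es0.
  have e0 : e = [ffun=> ord0].
    apply/ffunP => t; rewrite ffunE; apply/eqP; apply: contraT => et.
    by have : t \in finset.set0 by [rewrite -es0 inE]; rewrite inE.
  move/eqP: g0; case; rewrite -ge e0 /signed_sum big1 ?addr0// => t _.
  by rewrite ffunE mulr0z.
have eE : e = single t (e t).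
  apply/ffunP => u; rewrite ffunE; case: eqP => [->//|ut].
  apply/eqP; apply: contraT => eu.
  by have : u \in [set t]%SET by [rewrite -et inE]; rewrite inE => /eqP.
have [ek|] : e = single t plus3 \/ e = single t minus3 \/ e t = ord0.
  rewrite {1 2}eE; case: (e t) => -[|[|[|//]]] lt3.
  - by right; right; apply: ord_inj.
  - by left; congr (single t _); apply: ord_inj; rewrite /= inordK.
  - by right; left; congr (single t _); apply: ord_inj; rewrite /= inordK.
- by rewrite {1}ek test_coef_plus normr0.
case=> [ek|e0]; first by move/negP: eneg; case; rewrite ek; apply: imset_f.
by have : t \in [set t]%SET by [rewrite inE]; rewrite -et inE e0 eqxx.
Qed.

End Riesz.

(** * Unions of quasi-independent sets *)

Section Backward.
Variables (R : realType) (G : topologicalZmodType).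
Local Notation V := (dual_group R G).
Local Notation C := R[i].
Variable N : nat.
Hypothesis N0 : (0 < N)%N.
Hypothesis tors : forall g : V, g *+ N = 0.

Lemma phase (z : C) : exists2 u : C, `|u| = 1 & u^* * z = `|z|.
Proof.
have [->|z0] := eqVneq z 0; first by exists 1; rewrite ?normr1// mulr0 normr0.
exists (z / `|z|); first by rewrite normrM normfV normr_id divff// normr_eq0.
rewrite fmorph_div /= mulrAC [_ * z]mulrC -normCK.
by rewrite (CrealP (normr_real z)) expr2 mulfK// normr_eq0.
Qed.

(** The phases of the parameters are those of the coefficients, so that the main
    terms of the correlation with the polynomial add up to the left-hand side. *)
Lemma class_bound (F : {fset V}) (a : V -> C) (B : C) (T : finType) (v : T -> V) (d : C) :
  0 \notin F -> (forall x, `|\sum_(g <- F) a g * g x| <= B) ->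
  (forall t, v t \in F) ->
  (forall e, signed_sum v e = 0 -> e = [ffun=> ord0]) -> 0 <= d <= 1 ->
  d * \sum_t `|a (v t)| <= 2 * B + 2 * d ^+ 2 * \sum_(g <- F) `|a g|.
Proof.
move=> F0 fB vF qi d01; have /andP[d0 d1] := d01.
pose es := enum {: {ffun T -> 'I_3}}.
have [pts [pts0 ptsP]] := averaging_points N0 tors
  ([seq signed_sum v e | e <- es] ++ [seq g + signed_sum v e | g <- (F : seq V), e <- es]).
have kills e : mean_kills pts (signed_sum v e).
  move=> e0; rewrite /mean ptsP ?mulr0//.
  by rewrite mem_cat map_f// mem_enum.
have killsF g e : g \in F -> mean_kills pts (g + signed_sum v e).
  move=> gF e0; rewrite /mean ptsP ?mulr0// mem_cat; apply/orP; right.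
  by apply/allpairsP; exists (g, e); rewrite gF mem_enum.
have [u u1 uP] : exists2 u : T -> C, forall t, `|u t| = 1 &
    forall t, (u t)^* * a (v t) = `|a (v t)|.
  have /choice[u uP] : forall t, exists w : C, `|w| = 1 /\ w^* * a (v t) = `|a (v t)|.
    by move=> t; have [w w1 w2] := phase (a (v t)); exists w.
  by exists u => t; have [] := uP t.
pose w t := d / 2 * u t.
have wE t : `|w t| = d / 2 by rewrite normrM u1 mulr1 ger0_norm// divr_ge0.
have iwE t : `|'i * w t| = d / 2 by rewrite normrM normCi mul1r.
have d2 : d / 2 <= 1 / 2 by rewrite ler_pM2r// invr_gt0.
pose f x := \sum_(g <- F) a g * g x.
pose I := mean pts (fun x => f x * test v w x).
have IB : `|I| <= 2 * B.
  have riesz_part w' : (forall t, `|w' t| = d / 2) ->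
      `|mean pts (fun x => f x * riesz v w' x)| <= B.
    move=> w'E; rewrite -[leRHS]mulr1 -(mean_riesz qi pts0 w' kills).
    by apply: mean_bound => // x; apply: riesz_ge0 => t; rewrite w'E.
  have -> : I = mean pts (fun x => f x * riesz v w x) +
      'i * mean pts (fun x => f x * riesz v (fun t => 'i * w t) x).
    rewrite -meanZ /mean -mulrDr -big_split /=; congr (_ * _).
    by apply: eq_bigr => x _; rewrite /test mulrDr mulrCA.
  apply: le_trans (ler_normD _ _) _; rewrite mulr_natl mulr2n; apply: lerD.
    exact: riesz_part.
  by rewrite normrM normCi mul1r; exact: riesz_part.
have IE : I = \sum_(g <- F) a g * mean pts (fun x => g x * test v w x).
  rewrite /I /f (_ : (fun x => _) = fun x => \sum_(g <- F) a g * (g x * test v w x)).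
    by rewrite mean_sum; apply: eq_bigr => g _; rewrite meanZ.
  by apply/funext => x; rewrite mulr_suml; apply: eq_bigr => g _; rewrite mulrA.
have main : \sum_(g <- F) a g * (\sum_(t | v t == g) 2 * (w t)^*) = d * \sum_t `|a (v t)|.
  rewrite mulr_sumr; under eq_bigr do rewrite mulr_sumr.
  rewrite (exchange_big_dep xpredT)//=; apply: eq_bigr => t _.
  rewrite -uP -big_filter (_ : [seq _ <- _ | _] = [:: v t]); last first.
    rewrite -(filter_pred1_uniq (fset_uniq F) (vF t)); apply: eq_filter => g.
    by rewrite /= eq_sym.
  rewrite big_seq1 /w rmorphM /= (CrealP _).
    by field.
  by rewrite ger0_real// divr_ge0.
have err : `|I - d * \sum_t `|a (v t)| | <= 2 * d ^+ 2 * \sum_(g <- F) `|a g|.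
  rewrite IE -main -sumrB mulr_sumr; apply: le_trans (ler_norm_sum _ _ _) _.
  rewrite [leLHS]big_seq [leRHS]big_seq; apply: ler_sum => g gF; rewrite -mulrBr normrM mulrC ler_wpM2r//.
  apply: mean_char_test_approx => // [|e].
    by apply: contraNneq F0 => <-.
  exact: killsF.
have lhs0 : 0 <= d * \sum_t `|a (v t)| by rewrite mulr_ge0// sumr_ge0.
rewrite -(ger0_norm lhs0) -[X in `|X|](subrK I) addrC.
by apply: le_trans (ler_normD _ _) _; rewrite lerD// distrC.
Qed.

(** The error in [class_bound] is quadratic in d and involves the whole of F, so the
    n inequalities can be added up: for d = 1 / (4 n) the total error is half of
    the main term. *)
Lemma union_qi_sidon (n : nat) (Q : 'I_n -> set V) (L : set V) :
  (forall i, quasi_independent (Q i)) -> L = \bigcup_i Q i ->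
  sidon_pointwise L (16 * n%:R ^+ 2).
Proof.
move=> qQ LE F a B FL fB.
have B0 : 0 <= B.
  apply: le_trans (fB 0); case: (\sum_(g <- F) _) => x y; exact: sqrtr_ge0.
pose Sa := \sum_(g <- F) normc (a g).
have nc0 (z : C) : 0 <= normc z by case: z => x y; exact: sqrtr_ge0.
have [n0|n0] := posnP n.
  subst n; rewrite (_ : F = fset0) ?big_seq_fset0 ?mulr_ge0 ?exprn_ge0//.
  apply/eqP; rewrite -fsubset0; apply/fsubsetP => g gF.
  by have := FL g gF; rewrite LE => -[[]].
have n1 : 1 <= n%:R :> R by rewrite ler1n.
pose d : R := (4 * n%:R)^-1.
have n4 : 1 <= 4 * n%:R :> R by move: n1; lra.
have d01 : 0 <= d <= 1.
  by rewrite invr_ge0 (le_trans ler01 n4) invf_le1// (lt_le_trans ltr01 n4).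
have part i : d * \sum_(g <- F | `[< Q i g >]) normc (a g) <= 2 * B + 2 * d ^+ 2 * Sa.
  pose Fi := [fset g in F | `[< Q i g >]]%fset.
  have FiP g : (g \in Fi) = (g \in F) && `[< Q i g >] by rewrite !inE.
  have F0 : 0 \notin F.
    apply/negP => F0; have := FL 0 F0; rewrite LE => -[j _ Qj].
    by case: (qQ j).
  have := @class_bound F a B%:C%C Fi (fun t => val t) d%:C%C F0.
  have -> : \sum_(g <- F | `[< Q i g >]) normc (a g) = \sum_(t : Fi) normc (a (val t)).
    rewrite -(big_seq_fsetE _ _ xpredT (fun g => normc (a g))) /= -big_filter.
    apply: perm_big; apply: uniq_perm; rewrite ?filter_uniq ?fset_uniq// => g.
    by rewrite mem_filter FiP andbC.
  have two : 2%:C%C = 2 :> C by exact: rmorph_nat.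
  move=> h; rewrite -lecR rmorphD !rmorphM /= !rmorph_sum two -expr2; apply: h.
  - by move=> x; rewrite lecR.
  - by move=> t; have := valP t; rewrite FiP => /andP[].
  - move=> e se0.
    have /qi_seqP qs := qQ i.
    pose e' g := if insub g is Some t then sign3 (e (t : Fi)) else 0.
    have e'E t : e' (val t) = sign3 (e t) by rewrite /e' valK.
    have := qs Fi (fset_uniq Fi).
    have FiQ : {in Fi, forall g, Q i g} by move=> g; rewrite FiP => /andP[_ /asboolP].
    move=> /(_ FiQ e').
    rewrite big_seq_fsetE /=.
    under eq_bigr do rewrite e'E.
    move=> /(_ _ se0) qe; apply/ffunP => t; rewrite ffunE.
    have : sign3 (e t) = 0.
      rewrite -e'E; apply: qe; last exact: valP.
      move=> g; rewrite /e'; case: insub => [s|]; last by [].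
      by case: (e s) => -[|[|[|//]]] ?.
    by case: (e t) => -[|[|[|//]]] lt3 // _; apply: ord_inj.
  - by rewrite -(rmorph0 (real_complex R)) -(rmorph1 (real_complex R)) !lecR.
have cover : Sa <= \sum_i \sum_(g <- F | `[< Q i g >]) normc (a g).
  under [leRHS]eq_bigr do rewrite big_mkcond.
  rewrite exchange_big /= /Sa [leLHS]big_seq [leRHS]big_seq; apply: ler_sum => g gF.
  have := FL g gF; rewrite LE => -[i _ Qi].
  rewrite (bigD1 i)//= ifT; last exact/asboolP.
  by rewrite lerDl sumr_ge0// => j _; case: ifP.
have /andP[d0 _] := d01.
have total : d * Sa <= n%:R * (2 * B + 2 * d ^+ 2 * Sa).
  apply: le_trans (ler_wpM2l d0 cover) _; rewrite mulr_sumr.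
  rewrite mulr_natl -[n in leRHS]card_ord -sumr_const; apply: ler_sum => i _; exact: part.
have nn : n%:R != 0 :> R by rewrite gt_eqF// (lt_le_trans ltr01 n1).
have n80 : 0 <= 8 * n%:R :> R by rewrite mulr_ge0.
have := ler_wpM2l n80 total.
have -> : 8 * n%:R * (d * Sa) = 2 * Sa by rewrite /d; field.
have -> : 8 * n%:R * (n%:R * (2 * B + 2 * d ^+ 2 * Sa)) = 16 * n%:R ^+ 2 * B + Sa.
  by rewrite /d; field.
rewrite -/Sa; lra.
Qed.

End Backward.

(** * Sidon sets in groups of bounded torsion *)

Lemma continuous_trig_poly (R : realType) (G : topologicalZmodType)
  (s : seq (dual_group R G)) (a : dual_group R G -> R[i]) :
  continuous (fun x => \sum_(g <- s) a g * g x : (R[i] : numFieldType)).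
Proof.
elim: s => [|g s IH] x.
  by under eq_fun do rewrite big_nil; exact: cvg_cst.
under eq_fun do rewrite big_cons; rewrite /continuous_at.
apply: cvgD; last exact: IH.
by apply: cvgM; [exact: cvg_cst|exact: dual_fun_continuous].
Qed.

(** The L^oo norm of a trigonometric polynomial is its supremum. *)
Lemma sidonP (R : realType) (G : topologicalZmodType)
    (mu : probability (borelType G) R) (L : set (dual_group R G)) :
  compact [set: G] -> is_haar mu -> ~ L 0 ->
  sidon mu L <-> exists2 S, 1 <= S & sidon_pointwise L S.
Proof.
move=> cG hmu L0; split=> [[_ [S sid]]|[S S1 sid]].
  exists (Num.max 1 S); first by rewrite le_max lexx.
  move=> F a B FL fB; rewrite -lee_fin EFinM.
  apply: le_trans (sid F a FL) _.
  apply: (@le_trans _ _ ((Num.max 1 S)%:E *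
      'N[mu]_(+oo) [(fun x => (normc (\sum_(g <- F) a g * g x))%:E)])%E).
    by rewrite lee_wpmul2r ?Lnorm_ge0// lee_fin le_max lexx orbT.
  rewrite lee_wpmul2l ?lee_fin ?le_max ?ler01//.
  exact: (@Loo_le R G mu (fun x => \sum_(g <- F) a g * g x)).
split=> //; exists S => F a FL.
pose f x := \sum_(g <- F) a g * g x.
have fN x : ((normc (f x))%:E <= 'N[mu]_(+oo) [(fun x => (normc (f x))%:E)])%E.
  by apply: (le_Loo cG hmu); exact: continuous_trig_poly.
have Nfin : ('N[mu]_(+oo) [(fun x => (normc (f x))%:E)] <=
    (\sum_(g <- F) normc (a g))%:E)%E.
  apply: Loo_le => x; rewrite -lecR rmorph_sum /=.
  have -> : (normc (f x))%:C%C = `|f x| :> R[i] by [].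
  apply: (@le_trans _ _ (\sum_(g <- F) `|a g * g x|)); first exact: ler_norm_sum.
  by apply: ler_sum => g _; rewrite normrM (dual_fun_norm g x) mulr1.
move: fN Nfin; rewrite -/f.
case: ('N[mu]_(+oo) [_])%E (Lnorm_ge0 mu +oo%E (fun x => (normc (f x))%:E)) => [r _ fr _|//|//].
rewrite -EFinM lee_fin; apply: sid => [//|x].
by rewrite -lee_fin; exact: fr.
Qed.

Theorem theorem1p2 (R : realType) (G : topologicalZmodType)
    (G_compact : compact [set: G]) (G_hausdorff : hausdorff_space G)
    (mu : probability (borelType G) R) (mu_haar : is_haar mu)
    (G_torsion : bounded_torsion (dual_group R G))
    (L : set (dual_group R G)) (L0 : ~ L 0) :
  sidon mu L <->
  exists (n : nat) (Q : 'I_n -> set (dual_group R G)),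
    (forall i, quasi_independent (Q i)) /\ L = \bigcup_i Q i.
Proof.
have [N N0 tors] := G_torsion.
rewrite (sidonP G_compact mu_haar L0); split=> [[S S1 sid]|[n [Q [qQ LE]]]].
  have [m fin] := sidon_colouring L0 S1 sid N0 tors.
  have [c cP] := colouring_compactness fin.
  exists m, (fun j => [set g | L g /\ c g = j]); split.
    by move=> j; apply/qi_seqP => s us sQ; exact: (cP j s us).
  apply/seteqP; split=> [g Lg|g [j _ []]//].
  by exists (c g).
exists (Num.max 1 (16 * n%:R ^+ 2)); first by rewrite le_max lexx.
move=> F a B FL fB; apply: le_trans (union_qi_sidon N0 tors qQ LE FL fB) _.
rewrite ler_wpM2r ?le_max ?lexx ?orbT//.
by apply: le_trans (fB 0); case: (\sum_(g <- F) _) => x y; exact: sqrtr_ge0.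
Qed.
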